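(* For every even positive integer $n$ and every two points $x,y\in\mathcal{B}_n$, where $\mathcal{B}_n=\{x\in\{0,1\}^{n+1}: |x|>n/2\}$, there is a bijection $f\colon\mathcal{B}_n\to\mathcal{B}_n$ such that $f(x)=y$, $f(y)=x$, and for all $z\neq w$ in $\mathcal{B}_n$, \[ \frac1{20}\le\frac{\mathrm{distance}(f(z),f(w))}{\mathrm{distance}(z,w)}\le 20 . \]
   Context: For a binary string $x$, $|x|$ denotes its Hamming weight (number of ones), and $\mathrm{distance}(\cdot,\cdot)$ denotes the Hamming distance between binary strings of equal length. *)

(* Defs.v *)
From mathcomp Require Import all_boot all_order all_algebra.
Set Implicit Arguments.
Unset Strict Implicit.
Unset Printing Implicit Defensive.

Definition hweight (m : nat) (x : m.-tuple bool) : nat :=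
  #|[set i : 'I_m | tnth x i]|.

Definition hdist (m : nat) (x y : m.-tuple bool) : nat :=
  #|[set i : 'I_m | tnth x i != tnth y i]|.

(* [n./2] is exactly n / 2 for even n, the only case of interest. *)
Definition upper_half (n : nat) : Type :=
  {x : n.+1.-tuple bool | n./2 < hweight x}.

(* Main.v *)
Require Import Defs.
From mathcomp Require Import all_boot all_order all_algebra.
From mathcomp Require Import zify.
Set Implicit Arguments.
Unset Strict Implicit.
Unset Printing Implicit Defensive.
Import Order.TTheory GRing.Theory Num.Theory.
Local Open Scope ring_scope.

(** The cube {0,1}^n and B_n are bi-Lipschitz equivalent, with constants 4 and
    5 in the two directions, and 4 * 5 = 20: conjugate the isometry of the cube
    given by a XOR.  The bijection comes from the partition of the cube into
    symmetric chains by parenthesis matching, each chain of the cube being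
    stretched onto its trace in the upper half.  It is computed by a one-pass
    automaton with a counter [s]: a 1 is copied and increments [s]; a 0 is copied
    and decrements [s] when [s > 0], and is turned into a 1 when [s = 0].  Started
    at 0, the automaton flips exactly the [u] unmatched zeros; the bijection
    starts it at [u./2], so that half of them are flipped, and records the parity
    of [u] in the additional bit.  Both Lipschitz estimates follow from potential
    arguments along two parallel runs of the automaton. *)

Definition dist (a b : nat) : nat := ((a - b) + (b - a))%N.

Fixpoint ham (x y : seq bool) : nat :=
  if (x, y) is (a :: x', b :: y') then ((a != b) + ham x' y')%N else 0%N.

Definition next (s : nat) (b : bool) : nat := if b then s.+1 else s.-1.

Fixpoint out (s : nat) (x : seq bool) : seq bool :=
  if x is b :: x' then (b || (s == 0%N)) :: out (next s b) x' else [::].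

Fixpoint flips (s : nat) (x : seq bool) : nat :=
  if x is b :: x' then (~~ b && (s == 0%N) + flips (next s b) x')%N else 0%N.

Fixpoint final (s : nat) (x : seq bool) : nat :=
  if x is b :: x' then final (next s b) x' else s.

Lemma size_out s x : size (out s x) = size x.
Proof. by elim: x s => //= b x IH s; rewrite IH. Qed.

Lemma count_out s x : count id (out s x) = (count id x + flips s x)%N.
Proof. by elim: x s => //= b x IH s; rewrite IH; case: b; lia. Qed.

(** Ones raise the counter, and only unflipped zeros lower it. *)
Lemma final_balance s x :
  (final s x + size x = s + (count id x).*2 + flips s x)%N.
Proof.
elim: x s => /= [|b x IH] s; first lia.
by have := IH (next s b); case: b; case: s => [|s] /=; lia.
Qed.

(** The surplus [s] absorbs, one by one, the first zeros that would be flipped. *)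
Lemma flips_add r s x : flips (r + s) x = (flips r x - s)%N.
Proof.
elim: x r s => //= b x IH r s; case: b => /=; first by rewrite -addSn IH.
case: r => [|r] /=; last by rewrite IH.
by have := IH 0%N s.-1; case: s => [|s]; rewrite !add0n /=; lia.
Qed.

Lemma flips_sub s x : flips s x = (flips 0 x - s)%N.
Proof. by rewrite -[s in LHS]add0n flips_add. Qed.

(** The potential is the gap between counters. On equal input bits, outputs differ only if one
    counter is 0 and the other is not, and then the gap drops by 1. Unequal bits cost at most 1 in
    output and 2 in gap. *)
Lemma ham_out s t x y : size x = size y ->
  (ham (out s x) (out t y) + dist (final s x) (final t y)
   <= dist s t + 3 * ham x y)%N.
Proof.
elim: x y s t => [|a x IH] [|b y] //= s t; first by rewrite muln0 addn0.
case=> /(IH _ (next s a) (next t b)); rewrite /dist.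
by case: a; case: b; case: s => [|s]; case: t => [|t] /=; lia.
Qed.

(** Unequal bits with equal outputs mean a 1 against a flipped 0, at counter 0: the gap grows by 1
    and pays. *)
Lemma ham_le_out s t x y : size x = size y ->
  (ham x y + dist s t
   <= dist (final s x) (final t y) + 3 * ham (out s x) (out t y))%N.
Proof.
elim: x y s t => [|a x IH] [|b y] //= s t; first by rewrite muln0 addn0.
case=> /(IH _ (next s a) (next t b)); rewrite /dist.
by case: a; case: b; case: s => [|s]; case: t => [|t] /=; lia.
Qed.

Lemma dist_flips s t x y : size x = size y ->
  (dist (flips s x) (flips t y) <= dist s t + 2 * ham x y)%N.
Proof.
elim: x y s t => [|a x IH] [|b y] //= s t.
case=> /(IH _ (next s a) (next t b)); rewrite /dist.
by case: a; case: b; case: s => [|s]; case: t => [|t] /=; lia.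
Qed.

Lemma dist_count x y : size x = size y ->
  (dist (count id x) (count id y) <= ham x y)%N.
Proof.
elim: x y => [|a x IH] [|b y] //= [/IH]; rewrite /dist.
by case: a; case: b; lia.
Qed.

Definition stretch (x : seq bool) : seq bool :=
  ~~ odd (flips 0 x) :: out (flips 0 x)./2 x.

(** With [u] unmatched zeros, strictness comes from the leading 1 if [u] is even, and from rounding
    up [u - u./2] if it is odd. *)
Lemma count_stretch x : ~~ odd (size x) ->
  ((size x)./2 < count id (stretch x))%N.
Proof.
move=> ev /=; rewrite count_out (flips_sub _./2).
by have := final_balance 0 x; lia.
Qed.

(** The higher start saves as many flips, so the run ends as it would from 0. *)
Lemma final_stretch x :
  (final (flips 0 x)./2 x + size x = (count id x).*2 + flips 0 x)%N.
Proof.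
have := final_balance (flips 0 x)./2 x.
by rewrite (flips_sub _./2); lia.
Qed.

Lemma ham_stretch x y : size x = size y ->
  (ham (stretch x) (stretch y) <= 4 * ham x y)%N.
Proof.
move=> sxy /=; have := ham_out (flips 0 x)./2 (flips 0 y)./2 sxy.
(* If the parity bits differ, the final counters differ in parity too; their gap of at least 1
   absorbs the rounding of the halves. *)
have := dist_flips 0 0 sxy; have := final_stretch x; have := final_stretch y.
rewrite /dist; lia.
Qed.

Lemma ham_le_stretch x y : size x = size y ->
  (ham x y <= 5 * ham (stretch x) (stretch y))%N.
Proof.
move=> sxy /=; have := ham_le_out (flips 0 x)./2 (flips 0 y)./2 sxy.
have := @dist_count (out (flips 0 x)./2 x) (out (flips 0 y)./2 y).
rewrite !size_out !count_out => /(_ sxy).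
rewrite !(flips_sub _./2).
(* The final counter is twice the output weight, minus the size and the parity of [flips 0 x], so
   its gap costs at most 2 per output difference plus the parity bit. *)
have := final_stretch x; have := final_stretch y.
rewrite /dist; lia.
Qed.

Definition bitxor (c x : seq bool) : seq bool :=
  [seq p.1 (+) p.2 | p <- zip c x].

Lemma ham_bitxor c x y : size c = size x -> size x = size y ->
  ham (bitxor c x) (bitxor c y) = ham x y.
Proof.
elim: c x y => [|c cs IH] [|a x] [|b y] //= [sx] [sy].
rewrite /bitxor /= -!/(bitxor _ _) IH //.
by case: c a b => [] [] [].
Qed.

Lemma bitxorC c x : bitxor c x = bitxor x c.
Proof.
elim: c x => [|c cs IH] [|a x] //=.
by rewrite /bitxor /= addbC; congr cons; apply: IH.
Qed.

Lemma bitxorK c x : size c = size x -> bitxor c (bitxor c x) = x.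
Proof.
elim: c x => [|c cs IH] [|a x] //= [sx].
by rewrite /bitxor /= addKb; congr cons; apply: IH.
Qed.

Lemma hamxx x : ham x x = 0%N.
Proof. by elim: x => //= a x ->; rewrite eqxx. Qed.

Lemma ham_eq0 x y : size x = size y -> ham x y = 0%N -> x = y.
Proof.
elim: x y => [|a x IH] [|b y] //= [sxy] /eqP.
by rewrite addn_eq0 eqb0 negbK => /andP[/eqP -> /eqP/IH ->].
Qed.

Lemma hweight_count m (x : m.-tuple bool) : hweight x = count id x.
Proof.
rewrite /hweight -sum1_card -sum1_count big_tuple.
by apply: eq_bigl => i; rewrite inE.
Qed.

Lemma ham_count x y : size x = size y ->
  ham x y = count (fun p => p.1 != p.2) (zip x y).
Proof. by elim: x y => [|a x IH] [|b y] //= [/IH ->]. Qed.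

Lemma hdist_ham m (x y : m.-tuple bool) : hdist x y = ham x y.
Proof.
rewrite ham_count ?size_tuple // /hdist -sum1_card -sum1_count.
rewrite (big_tuple _ _ (zip_tuple x y)).
apply: eq_bigl => i; rewrite inE !(tnth_nth false) (tnth_nth (false, false)).
by rewrite /= nth_zip // !size_tuple.
Qed.

(** Complementing all bits swaps the two halves; the length [n.+1] is odd, so there are no ties. *)
Lemma card_upper_half n : ~~ odd n ->
  #|{: {x : n.+1.-tuple bool | (n./2 < hweight x)%N}}| = (2 ^ n)%N.
Proof.
move=> n_even; rewrite card_sig.
pose A := [pred x : n.+1.-tuple bool | (n./2 < hweight x)%N].
pose neg (x : n.+1.-tuple bool) := map_tuple negb x.
have negK : involutive neg.
  by move=> x; apply: val_inj; rewrite /= mapK //; apply: negbK.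
have eqA : #|[predC A]| = #|A|.
  rewrite -(card_image (inv_inj negK) A); apply: eq_card => x.
  rewrite -[x in RHS]negK (mem_image (inv_inj negK)) !inE !hweight_count.
  rewrite /= count_map; have := count_predC id x; rewrite size_tuple.
  have -> : count (preim negb id) x = count (predC id) x by [].
  by move: (count id x) (count (predC id) x) => a b; lia.
have /eqP := cardC A; rewrite eqA addnn -mul2n card_tuple card_bool expnS.
by rewrite eqn_pmul2l // => /eqP.
Qed.

Theorem corollary1p3 (n : nat) (n_gt0 : (0 < n)%N) (n_even : ~~ odd n)
    (x y : upper_half n) :
  exists f : upper_half n -> upper_half n,
    [/\ bijective f, f x = y, f y = x &
        forall z w : upper_half n, z <> w ->
          1 / 20 <= ((hdist (val (f z)) (val (f w)))%:R
                       / (hdist (val z) (val w))%:R : rat) <= 20].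
Proof.
pose B : finType := {x : n.+1.-tuple bool | (n./2 < hweight x)%N}.
have sz (t : n.-tuple bool) : size (stretch t) == n.+1.
  by rewrite /= size_out size_tuple.
have upper (t : n.-tuple bool) : (n./2 < hweight (Tuple (sz t)))%N.
  rewrite hweight_count -[n in n./2](size_tuple t).
  by apply: count_stretch; rewrite size_tuple.
pose h (t : n.-tuple bool) : B := exist _ (Tuple (sz t)) (upper t).
have h_le (t t' : n.-tuple bool) :
    (ham (val (h t)) (val (h t')) <= 4 * ham t t')%N.
  by apply: ham_stretch; rewrite !size_tuple.
have le_h (t t' : n.-tuple bool) :
    (ham t t' <= 5 * ham (val (h t)) (val (h t')))%N.
  by apply: ham_le_stretch; rewrite !size_tuple.
have h_inj : injective h.
  move=> t t' eq_h; apply/val_inj/ham_eq0; first by rewrite !size_tuple.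
  by apply/eqP; rewrite -leqn0; have := le_h t t'; rewrite eq_h hamxx muln0.
have [g hK gK] : bijective h.
  by apply: inj_card_bij => //; rewrite card_upper_half // card_tuple card_bool.
have szx (c t : n.-tuple bool) : size (bitxor c t) == n.
  by rewrite size_map size_zip !size_tuple minnn.
pose X (c t : n.-tuple bool) := Tuple (szx c t).
have XK c : involutive (X c).
  by move=> t; apply/val_inj/bitxorK; rewrite !size_tuple.
have XC c t : X c t = X t c by apply/val_inj/bitxorC.
(* XOR with this mask exchanges [g x] and [g y]. *)
pose c := X (g x) (g y).
pose f (z : B) : B := h (X c (g z)).
have fK : involutive f by move=> z; rewrite /f hK XK gK.
have fxy : f x = y by rewrite /f /c XC XK gK.
have f_le z w : (ham (val (f z)) (val (f w)) <= 20 * ham (val z) (val w))%N.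
  have := h_le (X c (g z)) (X c (g w)); have := le_h (g z) (g w).
  rewrite !gK /= ham_bitxor ?size_tuple //; rewrite /f /=; lia.
exists f; split=> //; first by exists f.
  by rewrite -fxy fK.
move=> z w neq_zw; rewrite !hdist_ham.
(* As [f] is an involution, the upper bound at the images is the lower bound. *)
have h1 := f_le z w; have h2 := f_le (f z) (f w).
rewrite !fK in h2.
have d_gt0 : (0 < ham (val z) (val w))%N.
  rewrite lt0n; apply/eqP => d0; apply: neq_zw.
  by apply/val_inj/val_inj/ham_eq0; rewrite ?size_tuple.
rewrite ler_pdivlMr ?ltr0n // ler_pdivrMr ?ltr0n //.
rewrite -natrM ler_nat h1 andbT mul1r mulrC ler_pdivrMr ?ltr0n //.
by rewrite -natrM ler_nat mulnC.
Qed.
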